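(* Let $U\subset\mathbb R$ be an interval with $u$ an interior point, and let $\{X(t,v):(t,v)\in U\times U\}$ be a real-valued random field. Suppose that for some $0<h<\eta$ the process $\{X(t,u):t\in U\}$ is $h$-localisable at $u$ with local form $X_u'(\cdot,u)$ and that $$\mathsf P\big(|X(v,v)-X(v,u)|\ge |v-u|^{\eta}\big)\to 0\quad\text{as } v\to u.$$ Then $Y=\{X(t,t):t\in U\}$ is $h$-localisable at $u$ with $Y_u'(\cdot)=X_u'(\cdot,u)$. In particular, this conclusion holds if (with $X(\cdot,u)$ $h$-localisable at $u$ as before), for some $p>0$ and $\eta>h$, $$\mathsf E\big(|X(v,v)-X(v,u)|^{p}\big)=O(|v-u|^{\eta p})\quad\text{as } v\to u.$$
   Context: Localisability: let $U\subset\mathbb R$ be an interval with $u$ an interior point and $h>0$. A real-valued random process $Y=\{Y(t):t\in U\}$ is $h$-localisable at $u$ with local form the random process $Y_u'=\{Y_u'(t):t\in\mathbb R\}$ if, as $r\searrow0$, the processes $t\mapsto (Y(u+rt)-Y(u))/r^{h}$ converge to $Y_u'$ in finite-dimensional distributions (for each fixed $t\in\mathbb R$ the expression is defined for all small enough $r$). Equality of local forms means equality of finite-dimensional distributions. $X_u'(\cdot,u)$ denotes the local form at $u$ of the process $t\mapsto X(t,u)$. *)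

(* Defs.v *)
From HB Require Export structures.
From mathcomp Require Export all_boot all_order all_algebra.
From mathcomp Require Export all_classical all_reals all_analysis.
Export Order.TTheory GRing.Theory Num.Theory numFieldNormedType.Exports.

Set Implicit Arguments.
Unset Strict Implicit.
Unset Printing Implicit Defensive.

Local Open Scope classical_set_scope.
Local Open Scope ring_scope.

(* Processes and fields indexed by a subset U of R (resp. U x U) are encoded as
   total functions of the parameter; only the values for parameters in U are
   required to be random variables, the other values are unconstrained. *)
Definition random_process (R : realType) (d : measure_display)
    (T : measurableType d) (U : set R) (Y : R -> T -> R) : Prop :=
  forall t, U t -> measurable_fun [set: T] (Y t).

Definition random_field (R : realType) (d : measure_display)
    (T : measurableType d) (U : set R) (X : R -> R -> T -> R) : Prop :=
  forall t v, U t -> U v -> measurable_fun [set: T] (X t v).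

(* For all times t_0, ..., t_(n-1), the random vectors (Y_r(t_i))_i converge in
   law to (Z(t_i))_i along F, i.e. the expectations of every bounded continuous
   function on R^n converge. The limit Z may live on another sample space. *)
Definition fdd_cvg (R : realType) (I : Type) (F : set_system I)
    (d d' : measure_display) (T : measurableType d) (T' : measurableType d')
    (P : probability T R) (Q : probability T' R)
    (Y : I -> R -> T -> R) (Z : R -> T' -> R) : Prop :=
  forall (n : nat) (t : 'I_n -> R) (f : 'rV[R]_n -> R),
    continuous f -> (exists M : R, forall x, `|f x| <= M) ->
    ('E_P[(fun w => f (\row_i Y r (t i) w))])%E @[r --> F] -->
    ('E_Q[(fun w => f (\row_i Z (t i) w))])%E.

(* Y is h-localisable at u with local form Z. When u is interior to U, the
   points u + r * t_i lie in U for all small r > 0, so that the values of Y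
   outside U do not matter. *)
Definition localisable (R : realType) (d d' : measure_display)
    (T : measurableType d) (T' : measurableType d')
    (P : probability T R) (Q : probability T' R)
    (U : set R) (h u : R) (Y : R -> T -> R) (Z : R -> T' -> R) : Prop :=
  [/\ random_process U Y, random_process [set: R] Z &
      fdd_cvg 0^'+ P Q
        (fun r t w => (Y (u + r * t) w - Y u w) / r `^ h) Z].

(* Main.v *)
Require Import Defs.
From mathcomp Require Import measurable_realfun ring lra.
(** Slutsky's argument. Write [A_r], [B_r] for the vectors of rescaled increments
    at [u + r t_i] of [t |-> X(t,u)] and of [t |-> X(t,t)]. They differ
    coordinatewise by [(X(v,u) - X(v,v)) / r^h] with [v = u + r t_i], and
    [|v - u|^eta <= e r^h] for small [r] because [h < eta]; hence [A_r - B_r]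
    tends to [0] in probability. For bounded continuous [f] this gives
    [E f(B_r) - E f(A_r) -> 0]: [f] is uniformly continuous on boxes, and the
    mass of [A_r] outside a large box is controlled by testing the convergence of
    [A_r] against the bounded continuous weight [min(1, |x|_1 / K)]. The moment
    condition implies the one in probability, with a smaller exponent, by
    Markov's inequality. *)

Set Implicit Arguments.
Unset Strict Implicit.
Unset Printing Implicit Defensive.

Local Open Scope classical_set_scope.
Local Open Scope ring_scope.

(** * Uniform continuity on boxes *)

Lemma continuous_rowP (R : realType) (n : nat) (f : 'rV[R]_n -> R)
    (x : 'rV[R]_n) (e : R) : {for x, continuous f} -> 0 < e ->
  exists2 r : R, 0 < r & forall y : 'rV[R]_n,
    (forall i, `|x ord0 i - y ord0 i| < r) -> `|f x - f y| < e.
Proof.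
move=> cf e0; have /cvgrPdist_lt/(_ _ e0)/nbhs_ballP[r /= r0 rf] := cf.
exists r => // y xy; apply: rf; split => // i j.
by rewrite ord1; exact: xy.
Qed.

(** Compactness of the box, in its near-covering form, turns the local radii into a common one. Only
    [x] is confined to the box: later [x] is a value of [A_r], whose tails are controlled, and [y]
    the nearby value of [B_r]. *)
Lemma continuous_box_uniform (R : realType) (n : nat) (f : 'rV[R]_n -> R)
    (K e : R) : continuous f -> 0 < e ->
  exists2 r : R, 0 < r & forall x y : 'rV[R]_n,
    (forall i, `|x ord0 i| <= K) -> (forall i, `|x ord0 i - y ord0 i| < r) ->
    `|f x - f y| < e.
Proof.
move=> cf e0.
have /compact_near_coveringP boxC : compact
    [set v : 'rV[R]_n | forall i, [set` `[- K, K]] (v ord0 i)].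
  by apply: (@rV_compact R n (fun=> [set` `[- K, K]])) => i; exact: segment_compact.
pose unif (r : R) (x : 'rV[R]_n) := forall y : 'rV[R]_n,
  (forall i, `|x ord0 i - y ord0 i| < r) -> `|f x - f y| < e.
have : \forall r \near 0^'+, [set v : 'rV[R]_n |
    forall i, [set` `[- K, K]] (v ord0 i)] `<=` unif r.
  apply: boxC => x _.
  have e20 : 0 < e / 2 by rewrite divr_gt0.
  have [r r0 rf] := continuous_rowP (cf x) e20.
  have r20 : 0 < r / 2 by rewrite divr_gt0.
  near=> x' s => y x'y.
  have xx' i : `|x ord0 i - x' ord0 i| < r / 2.
    have [_ +] : ball x (r / 2) x' by near: x'; exact: nbhsx_ballx.
    by apply.
  have sr : s < r / 2 by near: s; exact: nbhs_right_lt.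
  rewrite -(subrKA (f x)) (splitr e) (le_lt_trans (ler_normD _ _))//.
  rewrite ltrD//.
    by rewrite distrC; apply: rf => i; rewrite (lt_trans (xx' i))//; lra.
  apply: rf => i; rewrite -(subrKA (x' ord0 i)) (splitr r).
  by rewrite (le_lt_trans (ler_normD _ _))// ltrD// (lt_trans (x'y i)).
move=> H; have [r [r0 Hr]] : exists r : R, 0 < r /\
    [set v : 'rV[R]_n | forall i, [set` `[- K, K]] (v ord0 i)] `<=` unif r.
  near (0:R)^'+ => r; exists r; split; first by near: r; exact: nbhs_right_gt.
  by near: r.
exists r => // x y xK; apply: Hr => i /=.
by rewrite in_itv/= -ler_norml.
Unshelve. all: by end_near. Qed.

(** * Measurability of continuous functions of a random vector *)

Lemma measurable_continuous_row (R : realType) (d : measure_display)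
    (T : measurableType d) (n : nat) (f : 'rV[R]_n -> R) (Y : 'I_n -> T -> R) :
  continuous f -> (forall i, measurable_fun [set: T] (Y i)) ->
  measurable_fun [set: T] (fun w => f (\row_i Y i w)).
Proof.
move=> cf mY.
(* [f] is the pointwise limit of its values at the points [q k (N k w)] of the
   grid of mesh [1 / (k + 1)], which take only countably many values. *)
pose q (k : nat) (z : 'rV[int]_n) : 'rV[R]_n :=
  \row_i ((z ord0 i)%:~R / k.+1%:R).
pose N (k : nat) (w : T) : 'rV[int]_n := \row_i Num.floor (k.+1%:R * Y i w).
apply: (@measurable_fun_cvg _ _ _ _ (fun k w => f (q k (N k w)))).
  move=> k _ B mB; rewrite setTI.
  (* The preimage splits along the countably many grid cells; each cell is a finite intersection of
     conditions on single coordinates. *)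
  have -> : (fun w => f (q k (N k w))) @^-1` B =
    \bigcup_(z in [set z | B (f (q k z))]) \bigcap_(i in [set: 'I_n])
      [set w | (z ord0 i)%:~R <= k.+1%:R * Y i w < (z ord0 i + 1)%:~R].
    apply/seteqP; split => [w /= Bw|w [z /= Bz zw]].
      by exists (N k w) => // i _ /=; rewrite mxE floor_itv.
    suff -> : N k w = z by [].
    apply/rowP => i; rewrite mxE; apply/eqP; rewrite floor_eq.
    exact: zw.
  rewrite bigcup_mkcond; apply: countable_bigcupT_measurable.
    exact: countableP.
  move=> z; case: ifPn => // _.
  apply: fin_bigcap_measurable => // i _.
  have mkY : measurable_fun [set: T] (fun w => k.+1%:R * Y i w).
    exact: measurable_funM.
  rewrite -[X in measurable X]setTI.
  rewrite [X in _ `&` X](_ : _ = (fun w => k.+1%:R * Y i w) @^-1`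
    [set` `[(z ord0 i)%:~R, (z ord0 i + 1)%:~R[]); first exact: mkY.
  by apply/seteqP; split => w /=; rewrite in_itv.
move=> w _; apply/cvgrPdist_lt => e e0.
have [r r0 rf] := continuous_rowP (cf (\row_i Y i w)) e0.
near=> k; apply: rf => i; rewrite !mxE.
have k0 : (0 : R) < k.+1%:R by [].
have kr : k.+1%:R^-1 < r.
  by near: k; exact: (near_infty_natSinv_lt (PosNum r0)).
have /andP[] := floor_itv (k.+1%:R * Y i w).
set m := Num.floor _ => mk mk1.
(* The rounding error is a fractional part divided by [k.+1], hence lies in [[0, 1 / k.+1)]. *)
have -> : Y i w - m%:~R / k.+1%:R = (k.+1%:R * Y i w - m%:~R) / k.+1%:R.
  by field; rewrite gt_eqF//; lra.
rewrite ger0_norm ?divr_ge0 ?subr_ge0// (le_lt_trans _ kr)//.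
rewrite ler_pdivrMr// mulVf ?gt_eqF//.
by move: mk1; rewrite intrD; lra.
Unshelve. all: by end_near. Qed.

(** * Union bound and expectations of bounded functions *)

(** Finite subadditivity. It passes from closeness in probability of each coordinate to that of all
    coordinates at once. *)
Lemma cvg_probability_bigcup0 (R : realType) (d : measure_display)
    (T : measurableType d) (P : probability T R) (I : Type) (F : set_system I)
    (FF : ProperFilter F) (J : finType) (D : J -> I -> set T) :
  (\forall r \near F, forall j, measurable (D j r)) ->
  (forall j, P (D j r) @[r --> F] --> (0%:E : \bar R)) ->
  P (\bigcup_j D j r) @[r --> F] --> (0%:E : \bar R).
Proof.
move=> mD D0.
have finJ : finite_set [set: J] by [].
apply: (@squeeze_cvge I F _ R (cst 0%:E) (fun r => P (\bigcup_j D j r))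
    (fun r => \sum_(j <- finmap.enum_fset (fset_set [set: J])) P (D j r))%E).
- near=> r; rewrite measure_ge0/= -fsbig_finite//.
  have mDr : forall j, measurable (D j r) by near: r.
  apply: content_sub_fsum => //.
  exact: (fin_bigcup_measurable finJ).
- exact: cvg_cst.
- rewrite [X in _ --> X](_ : _ = \sum_(j <- finmap.enum_fset (fset_set [set: J])) 0%E)%E.
    by apply: cvg_nnesum => j _; [exact: nearW | exact: D0].
  by rewrite big1.
Unshelve. all: by end_near. Qed.

Lemma integrable_bounded (R : realType) (d : measure_display)
    (T : measurableType d) (P : probability T R) (f : T -> R) (M : R) :
  measurable_fun [set: T] f -> (forall w, `|f w| <= M) ->
  P.-integrable [set: T] (EFin \o f).
Proof.
move=> mf fM; apply: measurable_bounded_integrable => //; first exact: fin_num_fun_lty.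
exists M; split; first exact: num_real.
by move=> x Mx w _; exact: le_trans (fM w) (ltW Mx).
Qed.

Lemma expectation_EFin (R : realType) (d : measure_display)
    (T : measurableType d) (P : probability T R) (f : T -> R) :
  P.-integrable [set: T] (EFin \o f) ->
  ('E_P[f])%E = (\int[P]_w f w)%:E.
Proof.
by move=> If; rewrite unlock /Rintegral fineK//; exact: integrable_fin_num.
Qed.

(** * A continuous tail weight and tightness of the limit *)

(** For [K > 0], a continuous majorant of the indicator of the complement of the box of half-side
    [K]; unlike the indicator, it is an admissible test function for convergence in law. *)
Definition tail_weight (R : realType) (n : nat) (K : R) (x : 'rV[R]_n) : R :=
  Num.min 1 ((\sum_i `|x ord0 i|) / K).

Lemma tail_weight_ge0 (R : realType) (n : nat) (K : R) (x : 'rV[R]_n) :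
  0 < K -> 0 <= tail_weight K x.
Proof.
move=> K0; rewrite /tail_weight le_min ler01 divr_ge0 ?sumr_ge0//.
exact: ltW.
Qed.

Lemma tail_weight_le1 (R : realType) (n : nat) (K : R) (x : 'rV[R]_n) :
  tail_weight K x <= 1.
Proof. by rewrite /tail_weight ge_min lexx. Qed.

Lemma norm_tail_weight_le1 (R : realType) (n : nat) (K : R) (x : 'rV[R]_n) :
  0 < K -> `|tail_weight K x| <= 1.
Proof. by move=> K0; rewrite ger0_norm ?tail_weight_le1 ?tail_weight_ge0. Qed.

Lemma tail_weight_lt1 (R : realType) (n : nat) (K : R) (x : 'rV[R]_n) i :
  0 < K -> tail_weight K x < 1 -> `|x ord0 i| <= K.
Proof.
move=> K0; rewrite /tail_weight gt_min ltxx/= ltr_pdivrMr// mul1r => /ltW.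
by apply: le_trans; rewrite (bigD1 i)//= lerDl sumr_ge0.
Qed.

Lemma continuous_tail_weight (R : realType) (n : nat) (K : R) :
  continuous (@tail_weight R n K).
Proof.
move=> /= x; pose g (y : 'rV[R]_n) : R^o := (\sum_i `|y ord0 i|) / K.
have cg : {for x, continuous g}.
  apply: (@cvgM R _ (nbhs x)); last exact: cvg_cst.
  apply: (@cvg_big R^o _ _ _ _ (@add_continuous R^o) _ (nbhs x)) => i _.
  by apply: (@cvg_norm R R^o _ (nbhs x)); exact: coord_continuous.
have c1 : {for x, continuous (cst 1 : 'rV[R]_n -> R^o)} by exact: cst_continuous.
exact: (continuous_min c1 cg).
Qed.

Lemma cvg_tail_weight (R : realType) (n : nat) (x : 'rV[R]_n) :
  tail_weight k.+1%:R x @[k --> \oo] --> (0 : R).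
Proof.
set s := \sum_i `|x ord0 i|.
have s0 : 0 <= s by rewrite sumr_ge0.
apply: (@squeeze_cvgr _ _ _ _ (cst 0) (fun k => s * k.+1%:R^-1)).
- apply: nearW => k; rewrite tail_weight_ge0//=.
  by rewrite /tail_weight ge_min lexx orbT.
- exact: cvg_cst.
- rewrite -[X in _ --> X](mulr0 s); apply: cvgM; first exact: cvg_cst.
  exact: cvg_harmonic.
Qed.

(** Dominated convergence with bound 1, since the weight of a fixed vector vanishes as [K] grows. It
    serves for the single law of the limit, with which the tails of the approximating vectors are
    then compared. *)
Lemma tail_weight_tight (R : realType) (d : measure_display)
    (T : measurableType d) (P : probability T R) (n : nat)
    (Z : 'I_n -> T -> R) (e : R) :
  (forall i, measurable_fun [set: T] (Z i)) -> 0 < e ->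
  exists2 K : R, 0 < K & \int[P]_w tail_weight K (\row_i Z i w) < e.
Proof.
move=> mZ e0.
have mtw k : measurable_fun [set: T] (fun w => tail_weight k.+1%:R (\row_i Z i w)).
  by apply: measurable_continuous_row => //; exact: continuous_tail_weight.
have : (\int[P]_w (tail_weight k.+1%:R (\row_i Z i w))%:E)%E @[k --> \oo]
    --> (\int[P]_w (cst 0%E) w)%E.
  apply: (@dominated_cvg _ _ _ _ _ _ _ _ (cst 1%E)) => //.
  - by move=> k; exact/measurable_EFinP.
  - move=> w _; apply: cvg_EFin; first exact: nearW.
    exact: cvg_tail_weight.
  - exact: finite_measure_integrable_cst.
  - by move=> k w _; rewrite lee_fin norm_tail_weight_le1.
rewrite integral_cst//= mul0e => /fine_cvgP[_ /cvgrPdist_lt/(_ _ e0)].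
case=> N _ /(_ N (leqnn N)) /=; rewrite sub0r normrN => NE.
exists N.+1%:R => //; exact: le_lt_trans (ler_norm _) NE.
Qed.

(** * Slutsky's theorem for random vectors *)

(** Measurability of [A] and [B] is asked eventually along [F], because increments of a process on
    [U] are random variables once their points lie in [U]. *)
Lemma cvg_expectation_row (R : realType) (d d' : measure_display)
    (T : measurableType d) (T' : measurableType d')
    (P : probability T R) (Q : probability T' R)
    (I : Type) (F : set_system I) (FF : ProperFilter F) (n : nat)
    (A B : I -> 'I_n -> T -> R) (Z : 'I_n -> T' -> R) :
  (\forall r \near F, forall i, measurable_fun [set: T] (A r i)) ->
  (\forall r \near F, forall i, measurable_fun [set: T] (B r i)) ->
  (forall i, measurable_fun [set: T'] (Z i)) ->
  (forall f : 'rV[R]_n -> R,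
    continuous f -> (exists M : R, forall x, `|f x| <= M) ->
    ('E_P[(fun w => f (\row_i A r i w))])%E @[r --> F] -->
    ('E_Q[(fun w => f (\row_i Z i w))])%E) ->
  (forall i (e : R), 0 < e ->
    P [set w | e <= `|A r i w - B r i w|] @[r --> F] --> (0%:E : \bar R)) ->
  forall f : 'rV[R]_n -> R,
    continuous f -> (exists M : R, forall x, `|f x| <= M) ->
    ('E_P[(fun w => f (\row_i B r i w))])%E @[r --> F] -->
    ('E_Q[(fun w => f (\row_i Z i w))])%E.
Proof.
move=> mA mB mZ AZ AB f cf [M0 fM0].
have [M [M1 fM]] : exists M : R, 0 < M /\ forall x, `|f x| <= M.
  exists (`|M0| + 1); split; first by rewrite ltr_pwDr.
  by move=> x; rewrite (le_trans (fM0 x))// (le_trans (ler_norm _))// lerDl.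
(* For bounded [g] the expectations are finite, so the extended-real convergence can be traded for
   convergence of real integrals. *)
have cvgR (Y : I -> 'I_n -> T -> R) (g : 'rV[R]_n -> R) N :
    (\forall r \near F, forall i, measurable_fun [set: T] (Y r i)) ->
    continuous g -> (forall x, `|g x| <= N) ->
    ('E_P[(fun w => g (\row_i Y r i w))])%E @[r --> F] -->
      ('E_Q[(fun w => g (\row_i Z i w))])%E <->
    \int[P]_w g (\row_i Y r i w) @[r --> F] --> \int[Q]_w g (\row_i Z i w).
  move=> mY cg gN.
  rewrite [X in _ --> X <-> _]expectation_EFin; last first.
    by apply: (@integrable_bounded _ _ _ _ _ N) => //; exact: measurable_continuous_row.
  have near_eq : \forall r \near F, ('E_P[(fun w => g (\row_i Y r i w))])%E =
      (\int[P]_w g (\row_i Y r i w))%:E.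
    near=> r; rewrite expectation_EFin//.
    have mYr : forall i, measurable_fun [set: T] (Y r i) by near: r.
    by apply: (@integrable_bounded _ _ _ _ _ N) => //; exact: measurable_continuous_row.
  split => [/fine_cvgP[_]|cY].
    by apply: cvg_trans; apply: near_eq_cvg; near=> r; rewrite /= (near near_eq r).
  have cYE : (\int[P]_w g (\row_i Y r i w))%:E @[r --> F] -->
      (\int[Q]_w g (\row_i Z i w))%:E by apply: cvg_EFin => //; exact: nearW.
  apply: cvg_trans cYE; apply: near_eq_cvg.
  by near=> r; rewrite /= (near near_eq r).
apply/(cvgR _ _ M) => //; apply/cvgrPdist_lt => e e0.
(* Error budget: [e / 4] for [f(A_r)] against the limit, [e / 4] for uniform continuity, and three
   terms [2 * M * (e / (16 * M)) = e / 8]: the bad event, the tail of [Z], and the difference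
   between the tails of [A_r] and [Z]. The total is [7 * e / 8]. *)
have M8 : 0 < e / (16 * M) by rewrite divr_gt0// mulr_gt0.
have [K K0 KZ] := tail_weight_tight Q mZ M8.
have cAf := AZ _ cf (ex_intro _ M fM).
move/(cvgR _ _ M mA cf fM)/cvgrPdist_lt : cAf => cAf.
have twM x : `|@tail_weight R n K x| <= 1 by exact: norm_tail_weight_le1.
have cAt := AZ _ (@continuous_tail_weight R n K) (ex_intro _ 1 twM).
move/(cvgR _ _ 1 mA (@continuous_tail_weight R n K) twM)/cvgrPdist_lt : cAt => cAt.
have e40 : 0 < e / 4 by rewrite divr_gt0.
have [s s0 fs] := continuous_box_uniform K cf e40.
pose D i r := [set w | s <= `|A r i w - B r i w|].
have mD : \forall r \near F, forall i, measurable (D i r).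
  near=> r => i; rewrite -[D i r]setTI; apply: measurable_fun_le => //.
  have mAr : forall i, measurable_fun [set: T] (A r i) by near: r.
  have mBr : forall i, measurable_fun [set: T] (B r i) by near: r.
  exact/measurableT_comp/measurable_funB.
have /fine_cvgP[_ /cvgrPdist_lt/(_ _ M8) cD] :=
  cvg_probability_bigcup0 FF mD (fun i => AB i s s0).
near=> r.
have mAr : forall i, measurable_fun [set: T] (A r i) by near: r.
have mBr : forall i, measurable_fun [set: T] (B r i) by near: r.
have mDr : forall i, measurable (D i r) by near: r.
pose DD := \bigcup_i D i r.
have mDD : measurable DD by exact: fin_bigcup_measurable.
pose a w : 'rV[R]_n := \row_i A r i w; pose b w : 'rV[R]_n := \row_i B r i w.
have mfa : measurable_fun [set: T] (f \o a) by exact: measurable_continuous_row.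
have mfb : measurable_fun [set: T] (f \o b) by exact: measurable_continuous_row.
have mta : measurable_fun [set: T] (tail_weight K \o a).
  by apply: measurable_continuous_row => //; exact: continuous_tail_weight.
(* On [DD], or where the weight is 1, the trivial bound [2 * M] is paid for by the matching term.
   Elsewhere [a w] lies in the box and [b w] is [s]-close to it, so uniform continuity applies. *)
have fab w : `|f (a w) - f (b w)| <=
    e / 4 + (2 * M * \1_DD w + 2 * M * tail_weight K (a w)).
  have tw0 := tail_weight_ge0 (a w) K0.
  have tw1 := tail_weight_le1 K (a w).
  have fab2 : `|f (a w) - f (b w)| <= 2 * M.
    by rewrite (le_trans (ler_normB _ _))// mulr_natl mulr2n lerD.
  have [Dw|nDw] := pselect (DD w).
    by rewrite indicE mem_set//=; nra.
  rewrite indicE memNset//=.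
  have [tlt1|] := ltP (tail_weight K (a w)) 1; last by nra.
  have : `|f (a w) - f (b w)| < e / 4.
    apply: fs => i; first exact: tail_weight_lt1 tlt1.
    by rewrite !mxE ltNge; apply/negP => sAB; apply: nDw; exists i.
  by nra.
have Ifa : P.-integrable [set: T] (EFin \o (f \o a)).
  by apply: (@integrable_bounded _ _ _ _ _ M) => // w; exact: fM.
have Ifb : P.-integrable [set: T] (EFin \o (f \o b)).
  by apply: (@integrable_bounded _ _ _ _ _ M) => // w; exact: fM.
have Ita : P.-integrable [set: T] (EFin \o (tail_weight K \o a)).
  by apply: (@integrable_bounded _ _ _ _ _ 1) => // w; exact: twM.
have ID : P.-integrable [set: T] (EFin \o (\1_DD : T -> R)).
  apply: (@integrable_bounded _ _ _ _ _ 1) => // w.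
  by rewrite indicE; case: (_ \in _); rewrite ?normr1 ?normr0.
have Ie : P.-integrable [set: T] (EFin \o cst (e / 4)).
  exact: finite_measure_integrable_cst.
have I2D : P.-integrable [set: T] (EFin \o (fun w => 2 * M * \1_DD w)).
  have := integrableZl (measurableT) (2 * M) ID.
  by apply: eq_integrable => // w _; rewrite /= EFinM.
have I2t : P.-integrable [set: T] (EFin \o (fun w => 2 * M * tail_weight K (a w))).
  have := integrableZl (measurableT) (2 * M) Ita.
  by apply: eq_integrable => // w _; rewrite /= EFinM.
have Isum : P.-integrable [set: T]
    (EFin \o (fun w => 2 * M * \1_DD w + 2 * M * tail_weight K (a w))).
  have := integrableD measurableT I2D I2t.
  by apply: eq_integrable => // w _; rewrite /= EFinD.
have Itot : P.-integrable [set: T]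
    (EFin \o (fun w => e / 4 + (2 * M * \1_DD w + 2 * M * tail_weight K (a w)))).
  have := integrableD measurableT Ie Isum.
  by apply: eq_integrable => // w _; rewrite /= EFinD.
have Isub : P.-integrable [set: T] (EFin \o (fun w => f (a w) - f (b w))).
  have := integrableB measurableT Ifa Ifb.
  by apply: eq_integrable => // w _; rewrite /= EFinB.
have Inorm : P.-integrable [set: T] (EFin \o (fun w => `|f (a w) - f (b w)|)).
  exact: integrable_norm.
have Eab : `|\int[P]_w f (a w) - \int[P]_w f (b w)| <=
    e / 4 + (2 * M * fine (P DD) + 2 * M * \int[P]_w tail_weight K (a w)).
  rewrite -RintegralB// (le_trans (le_normr_Rintegral _ _))//.
  rewrite (le_trans (le_Rintegral _ Inorm Itot _))//.
  rewrite (RintegralD _ Ie Isum)// (RintegralD _ I2D I2t)//.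
  rewrite (RintegralZl _ _ ID)// (RintegralZl _ _ Ita)//.
  have -> : \int[P]_w cst (e / 4) w = e / 4.
    by rewrite Rintegral_cst//= probability_setT mulr1.
  have -> // : \int[P]_w \1_DD w = fine (P DD).
  by rewrite /Rintegral integral_indic// setIT.
have H1 : `|\int[Q]_w f (\row_i Z i w) - \int[P]_w f (a w)| < e / 4.
  by rewrite /a; near: r; exact: cAf.
have H2 : `|\int[Q]_w tail_weight K (\row_i Z i w) -
    \int[P]_w tail_weight K (a w)| < e / (16 * M).
  by rewrite /a; near: r; exact: cAt.
have H3 : fine (P DD) < e / (16 * M).
  have : `|0 - fine (P DD)| < e / (16 * M) by rewrite /DD; near: r.
  by rewrite sub0r normrN; apply: le_lt_trans; exact: ler_norm.
(* The tail of [A_r] is inherited from that of [Z] by convergence in law tested on the weight. *)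
have H4 : \int[P]_w tail_weight K (a w) < e / (16 * M) + e / (16 * M).
  by move: H2; rewrite ltr_norml; lra.
have H5 : 2 * M * (e / (16 * M)) = e / 8 by field; rewrite gt_eqF.
rewrite -(subrKA (\int[P]_w f (a w))) (le_lt_trans (ler_normD _ _))//.
have : 2 * M * fine (P DD) + 2 * M * \int[P]_w tail_weight K (a w) <
    2 * M * (e / (16 * M)) +
    2 * M * (e / (16 * M) + e / (16 * M)).
  by rewrite ltrD// ltr_pM2l// mulr_gt0.
by rewrite mulrDr H5; move: Eab H1 e0; rewrite /a /b; lra.
Unshelve. all: by end_near. Qed.

(** * Limits in punctured neighbourhoods *)

(** With [t != 0] the ray never meets [u] for [r > 0], so assumptions as [v] tends to [u] can be
    pulled back to [r]. *)
Lemma cvg_ray_dnbhs (R : realType) (u t : R) : t != 0 ->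
  u + r * t @[r --> 0^'+] --> u^'.
Proof.
move=> t0 S uS.
have ru : u + r * t @[r --> 0^'+] --> u.
  apply: cvg_at_right_filter.
  have : u + r * t @[r --> (0 : R)] --> u + 0 * t.
    apply: cvgD; first exact: cvg_cst.
    by apply: cvgM; [exact: cvg_id|exact: cvg_cst].
  by rewrite mul0r addr0.
have uS' : \forall r \near (0 : R)^'+, u + r * t != u -> S (u + r * t) := ru _ uS.
suff : \forall r \near (0 : R)^'+, S (u + r * t) by [].
near=> r; have : u + r * t != u -> S (u + r * t) by near: r; exact: uS'.
by apply; rewrite -subr_eq0 addrAC subrr add0r mulf_neq0// gt_eqF.
Unshelve. all: by end_near. Qed.

Lemma cvg_norm_dnbhs (R : realType) (u : R) :
  `|v - u| @[v --> u^'] --> (0 : R)^'+.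
Proof.
move=> S S0.
have vu : `|v - u| @[v --> u] --> (0 : R).
  have : `|v - u| @[v --> u] --> `|u - u|.
    by apply: cvg_norm; apply: cvgB; [exact: cvg_id|exact: cvg_cst].
  by rewrite subrr normr0.
have S0' : \forall v \near u, 0 < `|v - u| -> S `|v - u| := vu _ S0.
suff : \forall v \near u^', S `|v - u| by [].
near=> v; have : 0 < `|v - u| -> S `|v - u|.
  by near: v; exact: nbhs_dnbhs S0'.
apply; rewrite normr_gt0 subr_eq0.
by near: v; exact: nbhs_dnbhs_neq.
Unshelve. all: by end_near. Qed.

(** * From a moment bound to a bound in probability *)

Lemma probability_powR_markov (R : realType) (d : measure_display)
    (T : measurableType d) (P : probability T R) (g : T -> R) (p s : R) :
  measurable_fun [set: T] g -> 0 < p -> 0 < s ->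
  ((s `^ p)%:E * P [set w | (s <= `|g w|)%R] <= 'E_P[(fun w => `|g w| `^ p)%R])%E.
Proof.
move=> mg p0 s0.
exact: (@markov _ _ _ P (mfun_Sub (mem_set mg)) (fun x => x `^ p) s s0
  (measurable_powR p) (fun r _ => powR_ge0 r p) (ge0_ler_powR (ltW p0))).
Qed.

(** Markov's inequality bounds the probability by [C * |v - u|^((theta - eta) * p)], which vanishes
    thanks to the strict gap. Here [theta] is the moment exponent and [eta] the smaller one in
    probability. *)
Lemma cvg_probability_of_moment (R : realType) (d : measure_display)
    (T : measurableType d) (P : probability T R) (u : R) (g : R -> T -> R)
    (p eta theta C : R) :
  0 < p -> eta < theta ->
  (\forall v \near u^', measurable_fun [set: T] (g v)) ->
  (\forall v \near u^', ('E_P[(fun w => `|g v w| `^ p)%R] <=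
     (C * `|v - u| `^ (theta * p))%R%:E)%E) ->
  P [set w | `|v - u| `^ eta <= `|g v w|] @[v --> u^'] --> (0%:E : \bar R).
Proof.
move=> p0 et mg Eg.
pose a := (theta - eta) * p.
have a0 : 0 < a by rewrite mulr_gt0// subr_gt0.
apply: (@squeeze_cvge _ _ _ R (cst 0%:E)
  (fun v => P [set w | `|v - u| `^ eta <= `|g v w|])
  (fun v => (C * `|v - u| `^ a)%:E)).
- near=> v; rewrite measure_ge0/=.
  have mgv : measurable_fun [set: T] (g v) by near: v.
  have Egv : ('E_P[(fun w => `|g v w| `^ p)%R] <=
     (C * `|v - u| `^ (theta * p))%R%:E)%E by near: v.
  have v0 : 0 < `|v - u|.
    by rewrite normr_gt0 subr_eq0; near: v; exact: nbhs_dnbhs_neq.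
  have := le_trans (probability_powR_markov P mgv p0 (powR_gt0 eta v0)) Egv.
  set E := [set w | _].
  have mE : measurable E.
    rewrite -[E]setTI; apply: measurable_fun_le => //.
    exact: measurableT_comp.
  rewrite -(fineK (fin_num_measure P _ mE)) -EFinM !lee_fin -powRrM.
  have -> : theta * p = eta * p + a by rewrite /a; ring.
  rewrite powRD; last by rewrite (gt_eqF v0) implybT.
  by rewrite mulrCA ler_pM2l// powR_gt0.
- exact: cvg_cst.
- apply: cvg_EFin; first exact: nearW.
  rewrite -[X in _ --> X](mulr0 C); apply: cvgM; first exact: cvg_cst.
  exact: (cvg_comp _ _ (@cvg_norm_dnbhs R u) (powR_cvg0 a0)).
Unshelve. all: by end_near. Qed.

(** * Localisability of the diagonal process *)

Lemma localisable_diagonal (R : realType) (d d' : measure_display)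
    (T : measurableType d) (T' : measurableType d')
    (P : probability T R) (Q : probability T' R)
    (U : set R) (u h eta : R) (X : R -> R -> T -> R) (Z : R -> T' -> R) :
  interior U u -> random_field U X -> h < eta ->
  localisable P Q U h u (fun t => X t u) Z ->
  P [set w | `|v - u| `^ eta <= `|X v v w - X v u w|] @[v --> u^']
    --> (0%:E : \bar R) ->
  localisable P Q U h u (fun t => X t t) Z.
Proof.
move=> Uu fX heta [_ mZ XZ] XP.
split=> [t Ut||n t]; [exact: fX|exact: mZ|].
have uU : U u := nbhs_singleton Uu.
have nearU s : \forall r \near 0^'+, U (u + r * s).
  have [->|s0] := eqVneq s 0; first by apply: nearW => r; rewrite mulr0 addr0.
  have := @cvg_ray_dnbhs R u s s0 U; apply.
  exact: nbhs_dnbhs Uu.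
apply: (@cvg_expectation_row R d d' T T' P Q R 0^'+ _ n
  (fun r i w => (X (u + r * t i) u w - X u u w) / r `^ h)
  (fun r i w => (X (u + r * t i) (u + r * t i) w - X u u w) / r `^ h)
  (fun i => Z (t i))).
- apply: filter_forall => i; near=> r.
  have Ur : U (u + r * t i) by near: r; exact: nearU.
  by apply: measurable_funM => //; apply: measurable_funB; exact: fX.
- apply: filter_forall => i; near=> r.
  have Ur : U (u + r * t i) by near: r; exact: nearU.
  by apply: measurable_funM => //; apply: measurable_funB; exact: fX.
- by move=> i; exact: mZ.
- exact: XZ.
- move=> i e e0.
  (* At time 0 the point is [u] itself, out of reach of the punctured limit; there both increments
     vanish and the event is empty. *)
  have [->|t0] := eqVneq (t i) 0.
    rewrite [X in X @ _ --> _](_ : _ = cst 0%E); first exact: cvg_cst.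
    apply/funext => r; rewrite mulr0 addr0.
    rewrite [X in P X](_ : _ = set0) ?measure0//.
    by apply/seteqP; split => // w /=; rewrite subrr normr0 leNgt e0.
  (* This is [|v - u|^eta / r^h] for [v = u + r * t i]; it tends to 0 because [h < eta]. *)
  have rt0 : r `^ (eta - h) * `|t i| `^ eta @[r --> 0^'+] --> (0 : R).
    rewrite -[X in _ --> X](mul0r (`|t i| `^ eta)); apply: cvgM.
      by apply: powR_cvg0; rewrite subr_gt0.
    exact: cvg_cst.
  have /cvgrPdist_le/(_ _ e0) rte := rt0.
  have XPi := cvg_comp _ _ (@cvg_ray_dnbhs R u _ t0) XP.
  apply: (@squeeze_cvge _ _ _ R (cst 0%:E) _ _ _ _ _ XPi); last exact: cvg_cst.
  near=> r; rewrite measure_ge0/=.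
  have Ur : U (u + r * t i) by near: r; exact: nearU.
  have r0 : 0 < r by near: r; exact: nbhs_right_gt.
  have rh0 : 0 < r `^ h by exact: powR_gt0.
  have rtr : r `^ (eta - h) * `|t i| `^ eta <= e.
    have : `|0 - r `^ (eta - h) * `|t i| `^ eta| <= e by near: r.
    by rewrite sub0r normrN; apply: le_trans; exact: ler_norm.
  set v := u + r * t i in Ur *.
  have le_e : `|v - u| `^ eta <= e * r `^ h.
    rewrite /v addrAC subrr add0r normrM (gtr0_norm r0) (powRM _ (ltW r0) (normr_ge0 _)).
    rewrite -[in r `^ eta](subrK h eta) powRD; last first.
      by rewrite (gt_eqF r0) implybT.
    by rewrite mulrAC ler_pM2r.
  (* The common term [X u u] cancels in the difference of increments, so a gap of at least [e]
     forces [|X v v - X v u| >= e * r^h >= |v - u|^eta]. *)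
  apply: le_measure; rewrite ?inE.
  + rewrite -[X in measurable X]setTI; apply: measurable_fun_le => //.
    apply: measurableT_comp => //; apply: measurable_funB => //;
    by apply: measurable_funM => //; apply: measurable_funB; exact: fX.
  + rewrite -[X in measurable X]setTI; apply: measurable_fun_le => //.
    by apply: measurableT_comp => //; apply: measurable_funB => //; exact: fX.
  move=> w /=; rewrite -mulrBl opprB addrA subrK normrM normfV.
  rewrite (gtr0_norm rh0) ler_pdivlMr// distrC; exact: le_trans.
Unshelve. all: by end_near. Qed.

Theorem theorem4p1 (R : realType) (d d' : measure_display)
    (T : measurableType d) (T' : measurableType d')
    (P : probability T R) (Q : probability T' R)
    (U : set R) (u h : R) (X : R -> R -> T -> R) (X'u : R -> T' -> R)
    (intervalU : is_interval U) (interior_u : interior U u)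
    (fieldX : random_field U X) (h_gt0 : 0 < h)
    (locX : localisable P Q U h u (fun t => X t u) X'u) :
  (forall eta : R, h < eta ->
     P [set w | `|v - u| `^ eta <= `|X v v w - X v u w|] @[v --> u^']
       --> (0%:E : \bar R) ->
     localisable P Q U h u (fun t => X t t) X'u)
  /\
  (forall p eta : R, 0 < p -> h < eta ->
     (exists C : R, \forall v \near u^',
        (('E_P[(fun w => `|X v v w - X v u w| `^ p)%R])
           <= (C * `|v - u| `^ (eta * p))%R%:E)%E) ->
     localisable P Q U h u (fun t => X t t) X'u).
Proof.
split=> [eta heta|p eta p0 heta [C XC]].
  exact: localisable_diagonal.
(* The midpoint leaves room on both sides: [theta < eta] gives decay in Markov's bound, and
   [h < theta] is what the diagonal argument requires. *)
pose theta := (h + eta) / 2.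
have htheta : h < theta by rewrite /theta; lra.
have thetaeta : theta < eta by rewrite /theta; lra.
apply: (localisable_diagonal interior_u fieldX htheta locX).
apply: (cvg_probability_of_moment p0 thetaeta _ XC).
have Unear : \forall v \near u^', U v by exact: nbhs_dnbhs interior_u.
near=> v; have Uv : U v by near: v.
by apply: measurable_funB; apply: fieldX => //; exact: nbhs_singleton interior_u.
Unshelve. all: by end_near. Qed.
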